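(* For any map $f\colon X\to Y$, $$\operatorname{cat}(f)\le \operatorname{TC}(f)\le \min\{\operatorname{TC}(X),\operatorname{cat}(f\times f)\}.$$
   Context: Conventions: all spaces are pointed, path-connected and of the homotopy type of a CW-complex, and (globally given) continuous maps preserve base points; maps defined on open subsets, and homotopies, are not required to be based. All invariants take values in $\{0,1,2,\dots,\infty\}$. For a map $g\colon A\to B$, $\operatorname{cat}(g)$ is the least $n\le\infty$ such that $A$ can be covered by $n+1$ open sets on each of which the restriction of $g$ is homotopic to a constant map. For a space $X$ let $X^I$ be the space of continuous maps $I=[0,1]\to X$ and $\pi\colon X^I\to X\times X$, $\pi(\alpha)=(\alpha(0),\alpha(1))$, the path fibration. For a map $f\colon X\to Y$, the topological complexity $\operatorname{TC}(f)$ is the least $n\le\infty$ such that $X\times X$ can be covered by $n+1$ open sets $U_0,\dots,U_n$ on each of which there is a continuous map $\sigma_i\colon U_i\to X^I$ with $(f\times f)\circ\pi\circ\sigma_i\simeq (f\times f)|_{U_i}$. The topological complexity of a space is $\operatorname{TC}(X)=\operatorname{TC}(\mathrm{id}_X)$ (equivalently, the least $n$ such that $X\times X$ is covered by $n+1$ open sets on each of which $\pi$ has a continuous section). *)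

(* Defs.v *)
From HB Require Import structures.
From mathcomp Require Import all_boot all_order all_algebra.
From mathcomp Require Import all_classical all_reals ereal topology normedtype homotopy.

Set Implicit Arguments.
Unset Strict Implicit.
Unset Printing Implicit Defensive.

Import Order.TTheory GRing.Theory Num.Theory.
Import numFieldNormedType.Exports.

Local Open Scope classical_set_scope.
Local Open Scope ring_scope.

(* Open subsets, balls and [0, 1] are used as types of their own, with the
   subspace topology of [set_type]: a map out of such a subset is defined
   on the subset only. *)

Section UnitInterval.
Context (R : realType).

Definition unit_interval : Type := set_type `[0%R : R, 1%R]%classic.

HB.instance Definition _ := Topological.on unit_interval.

Lemma unit_interval_zero_subproof : (0 : R) \in `[0%R : R, 1%R]%classic.
Proof. by rewrite inE/= in_itv/= lexx ler01. Qed.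

Lemma unit_interval_one_subproof : (1 : R) \in `[0%R : R, 1%R]%classic.
Proof. by rewrite inE/= in_itv/= lexx ler01. Qed.

Let i0 : unit_interval := exist _ 0 unit_interval_zero_subproof.
Let i1 : unit_interval := exist _ 1 unit_interval_one_subproof.

Lemma unit_interval_zero_one_subproof : i0 != i1.
Proof. by apply/eqP => /(congr1 set_val)/eqP; rewrite /= eq_sym oner_eq0. Qed.

(* [zero] and [one] are the endpoints 0 and 1. *)
HB.instance Definition _ :=
  isBiPointed.Build unit_interval unit_interval_zero_one_subproof.

End UnitInterval.

Section Homotopy.
Context (R : realType).

Definition path_connected_space (X : topologicalType) : Prop :=
  forall x y : X, inhabited {path (unit_interval R) from x to y}.

Definition homotopic (A B : topologicalType) (g h : A -> B) : Prop :=
  exists H : A * unit_interval R -> B,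
    [/\ continuous H, forall a, H (a, zero) = g a & forall a, H (a, one) = h a].

Definition homotopy_equivalent (X Y : topologicalType) : Prop :=
  exists (g : X -> Y) (h : Y -> X),
    [/\ continuous g, continuous h,
        homotopic (h \o g) idfun & homotopic (g \o h) idfun].

End Homotopy.

(* 'rV[R]_n carries the product topology, and the ball is the Euclidean one;
   for n = 0 it is a point, which is interior. *)
Definition cball (R : realType) (n : nat) : set 'rV[R]_n :=
  [set v | \sum_i v 0 i ^+ 2 <= 1].
Arguments cball : clear implicits.

Section CWComplex.
Context (R : realType).

Definition cball_interior (n : nat) : set (cball R n) :=
  [set v | \sum_i (set_val v : 'rV[R]_n) 0 i ^+ 2 < 1].

Definition cball_boundary (n : nat) : set (cball R n) :=
  [set v | \sum_i (set_val v : 'rV[R]_n) 0 i ^+ 2 = 1].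

(* Characteristic maps [Phi e] of cells [e] of dimension [dim e].  The second
   and third clauses say that the open cells [Phi e @` @cball_interior _]
   partition X and that each [Phi e] is injective on the interior; that it is a
   homeomorphism from the interior onto the open cell then follows from the
   other clauses.  The last two are closure-finiteness and the weak topology. *)
Definition is_CW_complex (X : topologicalType) : Prop :=
  hausdorff_space X /\
  exists (cell : Type) (dim : cell -> nat) (Phi : forall e, cball R (dim e) -> X),
    [/\ forall e, continuous (Phi e),
        forall x, exists e, exists2 v, cball_interior v & Phi e v = x,
        forall e v e' v', cball_interior v -> cball_interior v' ->
          Phi e v = Phi e' v' ->
          existT (fun c => cball R (dim c)) e v = existT _ e' v',
        forall e, exists2 F : set cell,
          finite_set F /\ (forall c, F c -> (dim c < dim e)%N) &
          Phi e @` @cball_boundary (dim e) `<=`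
            \bigcup_(c in F) (Phi c @` @cball_interior (dim c)) &
        forall A : set X, (forall e, closed (Phi e @^-1` A)) -> closed A].

Definition has_CW_homotopy_type (X : topologicalType) : Prop :=
  exists2 K : topologicalType, is_CW_complex K & homotopy_equivalent R X K.

End CWComplex.

Section Invariants.
Context (R : realType).

(* The least element of P, and +oo if P is empty (see [leastP], [least_pinfty]). *)
Definition least (P : set nat) : \bar R := ereal_inf [set n%:R%:E | n in P].

Lemma leastP (P : set nat) (n : nat) :
  P n -> (forall m, P m -> (n <= m)%N) -> least P = n%:R%:E.
Proof.
move=> Pn nP; apply/eqP; rewrite eq_le; apply/andP; split.
  by apply: ereal_inf_lbound; exists n.
by apply: le_ereal_inf_tmp => _ [m Pm <-]; rewrite lee_fin ler_nat nP.
Qed.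

Lemma least_pinfty (P : set nat) : (forall n, ~ P n) -> least P = +oo%E.
Proof.
move=> P0; rewrite /least (_ : [set _ | _ in _] = set0) ?ereal_inf0//.
by apply/seteqP; split=> // y [n Pn _]; case: (P0 n Pn).
Qed.

Definition open_cover (A : topologicalType) (n : nat)
    (U : 'I_n.+1 -> set A) : Prop :=
  (forall i, open (U i)) /\ (forall a, exists i, U i a).

Definition ls_cat (A B : topologicalType) (g : A -> B) : \bar R :=
  least [set n | exists2 U : 'I_n.+1 -> set A, open_cover U &
    forall i, exists b : B, homotopic R (g \o (set_val : U i -> A)) (cst b)].

(* The space X^I, with the compact-open topology. *)
Definition path_space (X : topologicalType) : Type :=
  continuousType (unit_interval R) X.

HB.instance Definition _ (X : topologicalType) :=
  Topological.copy (path_space X)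
    (initial_topology
       (id : path_space X -> {compact-open, unit_interval R -> X})).

Definition path_fibration (X : topologicalType) (p : path_space X) : X * X :=
  (p zero, p one).

Definition square_map (X Y : Type) (f : X -> Y) (p : X * X) : Y * Y :=
  (f p.1, f p.2).

Definition TC (X Y : topologicalType) (f : X -> Y) : \bar R :=
  least [set n | exists2 U : 'I_n.+1 -> set (X * X)%type, open_cover U &
    forall i, exists2 sigma : U i -> path_space X, continuous sigma &
      homotopic R (square_map f \o @path_fibration X \o sigma)
                  (square_map f \o (set_val : U i -> X * X))].

Definition TC_space (X : topologicalType) : \bar R := TC (@idfun X).

End Invariants.

(* Main.v *)
Require Import Defs.
From mathcomp Require Import all_boot all_order all_algebra.
From mathcomp Require Import all_classical all_reals ereal topology normedtype homotopy.
From mathcomp Require Import lra.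

(** Each of the three inequalities turns an open cover that is admissible for
    the larger invariant into one with equally many members that is
    admissible for the smaller one; [least_le] then compares the two minima.

    - [ls_cat_le_TC]: restrict a cover of [X * X] to the slice of the pairs
      [(point, x)].  On a member of the restricted cover, the partial motion
      planner [sigma] gives paths from [sigma zero] to [sigma one], and its
      homotopy compares, after applying [f] to both coordinates, the endpoints
      of these paths with [(point, x)].  So [f] deforms to [f] of the end of
      the path (second coordinate of the homotopy), then along the path to [f]
      of its start, then to the constant [f point] (first coordinate).
    - [TC_le_TC_space]: a motion planner for [X] is one for [f], because its
      homotopy can be composed with [f * f].
    - [TC_le_ls_cat_square]: where [f * f] is homotopic to a constant, the
      planner that always answers with the constant path at [point] will do:
      composing it with [f * f] gives another constant, and two constant maps
      into the path-connected space [Y * Y] are homotopic.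

    What remains is the calculus of homotopies: they can be composed with
    maps, reversed, concatenated and paired.  Moving along the paths of
    [sigma] is a homotopy ([homotopic_path_ends]) because the unit interval is
    locally compact and Hausdorff, so that a continuous map into the space of
    paths with the compact-open topology can be uncurried. *)

Set Implicit Arguments.
Unset Strict Implicit.
Unset Printing Implicit Defensive.

Import Order.TTheory GRing.Theory Num.Theory.
Import numFieldNormedType.Exports.

Local Open Scope classical_set_scope.
Local Open Scope ring_scope.

(** * Continuous maps into products, subspaces and pieces *)

Section ContinuousPairing.
Context (A B C : topologicalType).

Lemma continuous_pair (u : A -> B) (v : A -> C) :
  continuous u -> continuous v -> continuous (fun a => (u a, v a)).
Proof. by move=> cu cv a; apply: cvg_pair => /=; [exact: cu | exact: cv]. Qed.

Lemma continuous_fst : continuous (@fst B C).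
Proof. by move=> x; exact: cvg_fst. Qed.

Lemma continuous_snd : continuous (@snd B C).
Proof. by move=> x; exact: cvg_snd. Qed.

Lemma continuous_compose (u : A -> B) (v : B -> C) :
  continuous u -> continuous v -> continuous (v \o u).
Proof. by move=> cu cv a; apply: continuous_comp; [exact: cu | exact: cv]. Qed.

End ContinuousPairing.

Lemma continuous_set_val (T : topologicalType) (A : set T) :
  continuous (set_val : A -> T).
Proof. exact: initial_continuous. Qed.

Lemma continuous_set_type (S T : topologicalType) (A : set T) (u : S -> A) :
  continuous (set_val \o u) -> continuous u.
Proof. by move=> cu; exact: continuous_comp_initial. Qed.

Lemma continuous_square_map (X Y : topologicalType) (f : X -> Y) :
  continuous f -> continuous (square_map f).
Proof.
move=> cf; apply: continuous_pair.
  by apply: continuous_compose => //; exact: continuous_fst.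
by apply: continuous_compose => //; exact: continuous_snd.
Qed.

(** The pasting lemma for the closed pieces [h <= c] and [h >= c].  Away from
    [h t = c] the map is locally [f] or locally [g]; where [h t = c] both have
    the same value, so a neighbourhood of it pulls back to one along each. *)
Lemma continuous_glue (R : realType) (T B : topologicalType) (c : R)
    (h : T -> R) (f g : T -> B) :
  continuous h -> continuous f -> continuous g ->
  (forall t, h t = c -> f t = g t) ->
  continuous (fun t => if h t <= c then f t else g t).
Proof.
move=> ch cf cg fg t W; have [htc|cht|htc] := ltgtP (h t) c => W_t.
- have fW : nbhs t (f @^-1` W) by exact: cf.
  have hc : nbhs t (h @^-1` [set r | r < c]).
    by apply: ch; exact: lt_nbhsl.
  by apply: filterS (filterI fW hc) => s [/= ? /ltW ->].
- have gW : nbhs t (g @^-1` W) by exact: cg.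
  have hc : nbhs t (h @^-1` [set r | c < r]).
    by apply: ch; exact: lt_nbhsr.
  by apply: filterS (filterI gW hc) => s [/= ? /lt_geF ->].
- have fW : nbhs t (f @^-1` W) by exact: cf.
  have gW : nbhs t (g @^-1` W) by apply: cg; rewrite /= -(fg _ htc).
  by apply: filterS (filterI fW gW) => s [/= ? ?]; case: ifP.
Qed.

(** * The unit interval *)

Section UnitIntervalTopology.
Context (R : realType).

Lemma set_val_zero : set_val (zero : unit_interval R) = 0 :> R.
Proof. by []. Qed.

Lemma set_val_one : set_val (one : unit_interval R) = 1 :> R.
Proof. by []. Qed.

Lemma clamp_subproof (t : R) :
  Num.max 0 (Num.min 1 t) \in `[0%R : R, 1%R]%classic.
Proof.
rewrite inE /= in_itv /= le_max lexx /= ge_max ler01 /=.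
by rewrite ge_min lexx.
Qed.

(** The retraction of the line onto the unit interval.  It makes every affine
    change of parameter a total continuous map into [unit_interval R], which
    spares the reparametrized homotopies any proof of bounds. *)
Definition clamp (t : R) : unit_interval R :=
  exist (fun r => r \in _) _ (clamp_subproof t).

Lemma clamp_val (t : R) : 0 <= t <= 1 -> set_val (clamp t) = t.
Proof. by case/andP=> t0 t1; rewrite set_valE /= (min_idPr t1) (max_idPr t0). Qed.

Lemma unit_interval_bounds (t : unit_interval R) : 0 <= set_val t <= 1.
Proof. by have := set_valP t; rewrite /= in_itv. Qed.

Lemma clamp_set_val (t : unit_interval R) : clamp (set_val t) = t.
Proof. by apply: val_inj; exact: (clamp_val (unit_interval_bounds t)). Qed.

Lemma clamp_le0 (t : R) : t <= 0 -> clamp t = zero.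
Proof.
move=> t0; apply: val_inj => /=.
by apply/max_idPl; rewrite ge_min t0 orbT.
Qed.

Lemma clamp_ge1 (t : R) : 1 <= t -> clamp t = one.
Proof.
by move=> t1; apply: val_inj => /=; rewrite (min_idPl t1) (max_idPr ler01).
Qed.

Lemma continuous_clamp : continuous clamp.
Proof.
apply: continuous_set_type => t /=.
by apply: continuous_max; [exact: cvg_cst | apply: continuous_min;
  [exact: cvg_cst | exact: cvg_id]].
Qed.

(** The interval is the image under the retraction [clamp] of the compact
    segment of the line. *)
Lemma unit_interval_compact : compact [set: unit_interval R].
Proof.
rewrite (_ : setT = clamp @` `[0, 1]%classic); last first.
  by apply/esym/seteqP; split=> // t _; exists (set_val t);
    [exact: set_valP | exact: clamp_set_val].
apply: continuous_compact; last exact: segment_compact.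
by apply: continuous_subspaceT; exact: continuous_clamp.
Qed.

Lemma unit_interval_hausdorff : hausdorff_space (unit_interval R).
Proof.
move=> s t st; apply: val_inj; apply: (@norm_hausdorff R R) => A B nA nB.
have [u [Au Bu]] := st _ _ (continuous_set_val nA) (continuous_set_val nB).
by exists (set_val u).
Qed.

Lemma unit_interval_locally_compact : locally_compact [set: unit_interval R].
Proof.
move=> t _; exists setT; first exact: filterT.
by split; [exact: unit_interval_compact | exact: closedT].
Qed.

End UnitIntervalTopology.

(** * Homotopies *)

Section HomotopyCalculus.
Context (R : realType).

Lemma homotopic_comp (A' A B C : topologicalType) (v : A' -> A) (u : B -> C)
    (g h : A -> B) :
  continuous v -> continuous u -> homotopic R g h ->
  homotopic R (u \o g \o v) (u \o h \o v).
Proof.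
move=> cv cu [H [cH H0 H1]].
exists (fun p => u (H (v p.1, p.2))); split=> [|a|a] /=; last 2 first.
- by rewrite H0.
- by rewrite H1.
apply: continuous_compose cu; apply: continuous_compose cH.
apply: continuous_pair; last exact: continuous_snd.
by apply: continuous_compose cv; exact: continuous_fst.
Qed.

Lemma homotopic_sym (A B : topologicalType) (g h : A -> B) :
  homotopic R g h -> homotopic R h g.
Proof.
move=> [H [cH H0 H1]].
exists (fun p => H (p.1, clamp (1 - set_val p.2))); split=> [|a|a] /=.
- apply: continuous_compose cH; apply: continuous_pair.
    exact: continuous_fst.
  apply: continuous_compose (@continuous_clamp R) => p.
  apply: cvgB; first exact: cvg_cst.
  by apply: continuous_compose p; [exact: continuous_snd |
    exact: continuous_set_val].
- by rewrite clamp_ge1 ?H1// set_val_zero subr0.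
- by rewrite clamp_le0 ?H0// set_val_one subrr.
Qed.

Lemma homotopic_trans (A B : topologicalType) (g h k : A -> B) :
  homotopic R g h -> homotopic R h k -> homotopic R g k.
Proof.
move=> [H [cH H0 H1]] [K [cK K0 K1]].
have ct : continuous (fun p : A * unit_interval R => set_val p.2 : R).
  by apply: continuous_compose; [exact: continuous_snd |
    exact: continuous_set_val].
exists (fun p => if set_val p.2 <= 2^-1 :> R
  then H (p.1, clamp (2 * set_val p.2))
  else K (p.1, clamp (2 * set_val p.2 - 1))); split=> [|a|a] /=.
- apply: continuous_glue => //.
  + apply: continuous_compose cH; apply: continuous_pair.
      exact: continuous_fst.
    apply: continuous_compose (@continuous_clamp R) => p.
    by apply: cvgMr; exact: ct.
  + apply: continuous_compose cK; apply: continuous_pair.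
      exact: continuous_fst.
    apply: continuous_compose (@continuous_clamp R) => p.
    by apply: cvgB; [apply: cvgMr; exact: ct | exact: cvg_cst].
  + by move=> p ->; rewrite divff ?pnatr_eq0// subrr clamp_ge1// clamp_le0// H1 K0.
- by rewrite set_val_zero invr_ge0 ler0n mulr0 clamp_le0// H0.
- rewrite set_val_one mulr1 ifF; last by apply/negbTE; rewrite -ltNge; lra.
  by rewrite clamp_ge1 ?K1//; lra.
Qed.

Lemma homotopic_cst (A B : topologicalType) (x y : B) :
  inhabited {path (unit_interval R) from x to y} ->
  homotopic R (cst x : A -> B) (cst y).
Proof.
case=> p; exists (fun q => p q.2); split=> [|a|a] /=; last 2 first.
- exact: path_zero.
- exact: path_one.
apply: continuous_compose (@cts_fun _ _ p); exact: continuous_snd.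
Qed.

Lemma homotopic_pair (A B C : topologicalType) (g h : A -> B) (g' h' : A -> C) :
  homotopic R g h -> homotopic R g' h' ->
  homotopic R (fun a => (g a, g' a)) (fun a => (h a, h' a)).
Proof.
move=> [H [cH H0 H1]] [K [cK K0 K1]].
exists (fun p => (H p, K p)); split=> [|a|a]; first exact: continuous_pair.
- by rewrite H0 K0.
- by rewrite H1 K1.
Qed.

(** The homotopy is evaluation [(a, t) |-> sigma a t].  Its joint continuity
    rests on the interval being locally compact and Hausdorff. *)
Lemma homotopic_path_ends (A X : topologicalType) (sigma : A -> path_space R X) :
  continuous sigma ->
  homotopic R (fun a => sigma a zero) (fun a => sigma a one).
Proof.
move=> csigma; exists (uncurry (fun a => sigma a : unit_interval R -> X)).
split=> //; apply: continuous_uncurry.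
- exact: unit_interval_locally_compact.
- exact: unit_interval_hausdorff.
(* The topology of [path_space] is induced by this inclusion. *)
- pose inj (p : path_space R X) : {compact-open, unit_interval R -> X} := p.
  have cinj : continuous inj by exact: initial_continuous.
  exact: continuous_compose csigma cinj.
- by move=> a; exact: cts_fun.
Qed.

End HomotopyCalculus.

(** * Comparison of the invariants *)

Section Invariants.
Context (R : realType).

Lemma least_le (P Q : set nat) : P `<=` Q -> (least R Q <= least R P)%E.
Proof. by move=> PQ; apply: ereal_inf_le_tmp; exact: image_subset. Qed.

(** On the slice of pairs [(point, x)], a motion planner contracts [f] by
    running its paths backwards to their start, which [f] carries, up to
    homotopy, to [f point]. *)
Lemma ls_cat_le_TC (X : ptopologicalType) (Y : topologicalType) (f : X -> Y) :
  continuous f -> (ls_cat R f <= TC R f)%E.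
Proof.
move=> cf; apply: least_le => n [U [oU UX] sU].
pose V i : set X := (fun x => (point, x)) @^-1` U i.
have cpair : continuous (fun x : X => (point : X, x)).
  by apply: continuous_pair => x; [exact: cvg_cst | exact: cvg_id].
exists V.
  split=> [i|x]; first exact: open_comp.
  by have [i Ui] := UX (point, x); exists i.
move=> i; exists (f point).
have [sigma csigma sigmaH] := sU i.
pose j (x : V i) : U i :=
    exist (fun p => p \in U i) (point, set_val x) (mem_set (set_valP x)).
have cj : continuous j.
  apply: continuous_set_type.
  exact: continuous_compose (@continuous_set_val _ _) cpair.
have start := homotopic_comp cj (@continuous_fst Y Y) sigmaH.
have finish := homotopic_comp cj (@continuous_snd Y Y) sigmaH.
have along := homotopic_comp cj cf (homotopic_path_ends csigma).
apply: homotopic_trans (homotopic_sym finish) _.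
exact: homotopic_trans (homotopic_sym along) start.
Qed.

Lemma TC_le_TC_space (X Y : topologicalType) (f : X -> Y) :
  continuous f -> (TC R f <= TC_space R X)%E.
Proof.
move=> cf; apply: least_le => n [U coverU sU]; exists U => // i.
have [sigma csigma sigmaH] := sU i; exists sigma => //.
have cid : continuous (@idfun (U i)) by move=> x; exact: cvg_id.
exact: (homotopic_comp cid (continuous_square_map cf) sigmaH).
Qed.

(** Constant maps into a path-connected space are homotopic, so a constant
    planner works wherever [square_map f] is null-homotopic. *)
Lemma TC_le_ls_cat_square (X : ptopologicalType) (Y : topologicalType)
    (f : X -> Y) :
  path_connected_space R Y -> (TC R f <= ls_cat R (square_map f))%E.
Proof.
move=> pcY; apply: least_le => n [U coverU sU]; exists U => // i.
have [[y1 y2] fH] := sU i.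
pose p : path_space R X := [the continuousType _ _ of cst point].
exists (cst p); first exact: cst_continuous.
apply: homotopic_trans (homotopic_sym fH).
have move_to := fun y => homotopic_cst (U i) (pcY (f point) y).
exact: homotopic_pair (move_to y1) (move_to y2).
Qed.
End Invariants.

Theorem proposition2p2 (R : realType) (X Y : ptopologicalType) (f : X -> Y)
    (pcX : path_connected_space R X) (pcY : path_connected_space R Y)
    (cwX : has_CW_homotopy_type R X) (cwY : has_CW_homotopy_type R Y)
    (cf : continuous f) (f_based : f point = point) :
  (ls_cat R f <= TC R f /\
   TC R f <= mine (TC_space R X) (ls_cat R (square_map f)))%E.
Proof.
split; first exact: ls_cat_le_TC.
by rewrite le_min TC_le_TC_space//= TC_le_ls_cat_square.
Qed.
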